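(* Every $\mathbf{LK_u}$-provable implicational Horn sequent $S$ has an $\mathbf{LK_u}$-proof of size $O(|S|^2)$.
   Context: Formulas. $\mathcal{L}_u$-formulas are built from atoms and constants $0,1$ by $\wedge,\vee,*,\to$. A sequent is $\Gamma\Rightarrow\Delta$ with $\Gamma,\Delta$ finite multisets. An $\mathcal{L}_u$-formula is implicational Horn if generated by $F::=p\mid1\mid \circledast_{i\in I}q_i\to p\mid p\to\circledast_{i\in I}q_i\mid F_1\wedge F_2$, with $p,q_i$ atoms, $I$ a nonempty finite set, and $\circledast_{i\in I}q_i$ the iterated $*$-product of the $q_i$. A sequent is implicational Horn if it is $\Gamma\Rightarrow p$ with $\Gamma$ a multiset of implicational Horn formulas and $p$ an atom. $\mathbf{LK_u}$ has axioms $A\Rightarrow A$, $\Rightarrow1$, $0\Rightarrow$ and rules: from $\Gamma\Rightarrow\Delta$ infer $\Gamma,1\Rightarrow\Delta$ and $\Gamma\Rightarrow0,\Delta$; from $\Gamma,A_i\Rightarrow\Delta$ infer $\Gamma,A_0\wedge A_1\Rightarrow\Delta$; from $\Gamma\Rightarrow A,\Delta$ and $\Gamma\Rightarrow B,\Delta$ infer $\Gamma\Rightarrow A\wedge B,\Delta$; from $\Gamma,A\Rightarrow\Delta$ and $\Gamma,B\Rightarrow\Delta$ infer $\Gamma,A\vee B\Rightarrow\Delta$; from $\Gamma\Rightarrow A_i,\Delta$ infer $\Gamma\Rightarrow A_0\vee A_1,\Delta$; from $\Gamma,A,B\Rightarrow\Delta$ infer $\Gamma,A*B\Rightarrow\Delta$;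 from $\Gamma\Rightarrow A,\Delta$ and $\Sigma\Rightarrow B,\Lambda$ infer $\Gamma,\Sigma\Rightarrow A*B,\Delta,\Lambda$; from $\Gamma\Rightarrow A,\Delta$ and $\Sigma,B\Rightarrow\Lambda$ infer $\Gamma,\Sigma,A\to B\Rightarrow\Delta,\Lambda$; from $\Gamma,A\Rightarrow B,\Delta$ infer $\Gamma\Rightarrow A\to B,\Delta$; cut: from $\Gamma\Rightarrow A,\Delta$ and $\Sigma,A\Rightarrow\Lambda$ infer $\Gamma,\Sigma\Rightarrow\Delta,\Lambda$; weakening (from $\Gamma\Rightarrow\Delta$ infer $\Gamma,A\Rightarrow\Delta$ and $\Gamma\Rightarrow A,\Delta$); contraction (from $\Gamma,A,A\Rightarrow\Delta$ infer $\Gamma,A\Rightarrow\Delta$; from $\Gamma\Rightarrow A,A,\Delta$ infer $\Gamma\Rightarrow A,\Delta$). Size = number of symbols. *)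

(* Defs.v *)
From HB Require Import structures.
From mathcomp Require Import all_boot finmap multiset.

Set Implicit Arguments.
Unset Strict Implicit.
Unset Printing Implicit Defensive.

Local Open Scope mset_scope.

Inductive form : Type :=
| Atom of nat
| Zero
| One
| And of form & form
| Or of form & form
| Star of form & form
| Imp of form & form.

(* Multisets {mset form} need a choiceType structure on form, obtained through
   an embedding into generic trees. *)
Fixpoint form_encode (A : form) : GenTree.tree nat :=
  match A with
  | Atom p => GenTree.Leaf p
  | Zero => GenTree.Node 0 [::]
  | One => GenTree.Node 1 [::]
  | And A B => GenTree.Node 2 [:: form_encode A; form_encode B]
  | Or A B => GenTree.Node 3 [:: form_encode A; form_encode B]
  | Star A B => GenTree.Node 4 [:: form_encode A; form_encode B]
  | Imp A B => GenTree.Node 5 [:: form_encode A; form_encode B]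
  end.

Fixpoint form_decode (t : GenTree.tree nat) : form :=
  match t with
  | GenTree.Leaf p => Atom p
  | GenTree.Node 1 _ => One
  | GenTree.Node 2 [:: a; b] => And (form_decode a) (form_decode b)
  | GenTree.Node 3 [:: a; b] => Or (form_decode a) (form_decode b)
  | GenTree.Node 4 [:: a; b] => Star (form_decode a) (form_decode b)
  | GenTree.Node 5 [:: a; b] => Imp (form_decode a) (form_decode b)
  | _ => Zero
  end.

Lemma form_encodeK : cancel form_encode form_decode.
Proof. by elim=> //= A -> B ->. Qed.

HB.instance Definition _ := Countable.copy form (can_type form_encodeK).

Record sequent : Type :=
  Sequent { antecedent : {mset form}; succedent : {mset form} }.

Declare Scope sequent_scope.
Delimit Scope sequent_scope with sequent.
Notation "G ==>s D" := (Sequent G%mset D%mset)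
  (at level 70, no associativity) : sequent_scope.
Local Open Scope sequent_scope.

(* Each atom, constant and connective counts as one symbol. Commas and
   parentheses, which would only change sizes by a constant factor, are not
   counted. *)
Fixpoint form_size (A : form) : nat :=
  match A with
  | Atom _ | Zero | One => 1
  | And A B | Or A B | Star A B | Imp A B => (form_size A + form_size B).+1
  end.

(* The successor accounts for the sequent arrow. *)
Definition sequent_size (S : sequent) : nat :=
  (\sum_(A <- antecedent S) form_size A
   + \sum_(A <- succedent S) form_size A).+1.

(* Iterated *-products of a nonempty finite family of atoms (repetitions
   allowed), in any order and with any bracketing. *)
Inductive atom_product : form -> Prop :=
| AP_atom q : atom_product (Atom q)
| AP_star Q R : atom_product Q -> atom_product R -> atom_product (Star Q R).

Inductive implicational_horn : form -> Prop :=
| IH_atom p : implicational_horn (Atom p)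
| IH_one : implicational_horn One
| IH_to_atom Q p : atom_product Q -> implicational_horn (Imp Q (Atom p))
| IH_from_atom p Q : atom_product Q -> implicational_horn (Imp (Atom p) Q)
| IH_and F1 F2 : implicational_horn F1 -> implicational_horn F2 ->
    implicational_horn (And F1 F2).

Definition implicational_horn_sequent (S : sequent) : Prop :=
  (forall F, F \in antecedent S -> implicational_horn F)
  /\ (exists p, succedent S = [mset Atom p]).

(* Tree-like proofs; exchange is implicit since cedents are multisets. *)
Inductive LKu_proof : sequent -> Type :=
| LKu_id A : LKu_proof ([mset A] ==>s [mset A])
| LKu_oneR : LKu_proof (mset0 ==>s [mset One])
| LKu_zeroL : LKu_proof ([mset Zero] ==>s mset0)
| LKu_oneL G D : LKu_proof (G ==>s D) -> LKu_proof (One +` G ==>s D)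
| LKu_zeroR G D : LKu_proof (G ==>s D) -> LKu_proof (G ==>s Zero +` D)
| LKu_andL0 G D A0 A1 :
    LKu_proof (A0 +` G ==>s D) -> LKu_proof (And A0 A1 +` G ==>s D)
| LKu_andL1 G D A0 A1 :
    LKu_proof (A1 +` G ==>s D) -> LKu_proof (And A0 A1 +` G ==>s D)
| LKu_andR G D A B :
    LKu_proof (G ==>s A +` D) -> LKu_proof (G ==>s B +` D) ->
    LKu_proof (G ==>s And A B +` D)
| LKu_orL G D A B :
    LKu_proof (A +` G ==>s D) -> LKu_proof (B +` G ==>s D) ->
    LKu_proof (Or A B +` G ==>s D)
| LKu_orR0 G D A0 A1 :
    LKu_proof (G ==>s A0 +` D) -> LKu_proof (G ==>s Or A0 A1 +` D)
| LKu_orR1 G D A0 A1 :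
    LKu_proof (G ==>s A1 +` D) -> LKu_proof (G ==>s Or A0 A1 +` D)
| LKu_starL G D A B :
    LKu_proof (A +` (B +` G) ==>s D) -> LKu_proof (Star A B +` G ==>s D)
| LKu_starR G D S L A B :
    LKu_proof (G ==>s A +` D) -> LKu_proof (S ==>s B +` L) ->
    LKu_proof (G `+` S ==>s Star A B +` (D `+` L))
| LKu_impL G D S L A B :
    LKu_proof (G ==>s A +` D) -> LKu_proof (B +` S ==>s L) ->
    LKu_proof (Imp A B +` (G `+` S) ==>s D `+` L)
| LKu_impR G D A B :
    LKu_proof (A +` G ==>s B +` D) -> LKu_proof (G ==>s Imp A B +` D)
| LKu_cut G D S L A :
    LKu_proof (G ==>s A +` D) -> LKu_proof (A +` S ==>s L) ->
    LKu_proof (G `+` S ==>s D `+` L)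
| LKu_weakL G D A : LKu_proof (G ==>s D) -> LKu_proof (A +` G ==>s D)
| LKu_weakR G D A : LKu_proof (G ==>s D) -> LKu_proof (G ==>s A +` D)
| LKu_contrL G D A :
    LKu_proof (A +` (A +` G) ==>s D) -> LKu_proof (A +` G ==>s D)
| LKu_contrR G D A :
    LKu_proof (G ==>s A +` (A +` D)) -> LKu_proof (G ==>s A +` D).

Definition LKu_provable (S : sequent) : Prop := inhabited (LKu_proof S).

Fixpoint proof_size (S : sequent) (P : LKu_proof S) : nat :=
  sequent_size S +
  match P with
  | LKu_id _ | LKu_oneR | LKu_zeroL => 0
  | LKu_oneL _ _ P1 | LKu_zeroR _ _ P1
  | LKu_andL0 _ _ _ _ P1 | LKu_andL1 _ _ _ _ P1
  | LKu_orR0 _ _ _ _ P1 | LKu_orR1 _ _ _ _ P1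
  | LKu_starL _ _ _ _ P1 | LKu_impR _ _ _ _ P1
  | LKu_weakL _ _ _ P1 | LKu_weakR _ _ _ P1
  | LKu_contrL _ _ _ P1 | LKu_contrR _ _ _ P1 => proof_size P1
  | LKu_andR _ _ _ _ P1 P2 | LKu_orL _ _ _ _ P1 P2
  | LKu_starR _ _ _ _ _ _ P1 P2 | LKu_impL _ _ _ _ _ _ P1 P2
  | LKu_cut _ _ _ _ _ P1 P2 => proof_size P1 + proof_size P2
  end.

(* Main.v *)
Require Import Defs.
From mathcomp Require Import all_boot finmap multiset.
From mathcomp Require Import zify.

(** Provability implies truth under every Boolean valuation, so it suffices to
    build a short proof of any classically valid implicational Horn sequent [S].
    Reading rules bottom-up: split conjunctions, drop [1], and replace an
    implication whose hypotheses are all atoms of the antecedent by the atoms of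
    its conclusion. Each move keeps the sequent valid and Horn and removes some
    [d >= 1] symbols, at a cost of [O(d |S|)] symbols of proof, because an
    implication is consumed when it fires. Hence by induction the total is
    [O(|S|^2)]. When no move applies, the valuation making true exactly the atoms
    of the antecedent satisfies the antecedent, so the succedent is one of these
    atoms and weakening finishes. *)

Set Implicit Arguments.
Unset Strict Implicit.
Unset Printing Implicit Defensive.

Local Open Scope mset_scope.
Local Open Scope sequent_scope.

(** * Multisets and their underlying lists *)

Section MultisetSum.
Variable K : choiceType.
Implicit Types (A B : {mset K}) (P : pred K).

Lemma perm_msetD A B : perm_eq (A `+` B) (A ++ B).
Proof.
apply/eq_seq_msetP/msetP => x.
by rewrite !mset_seqE count_cat !count_mem_mset msetE2.
Qed.

Lemma all_msetD P A B : all P (A `+` B) = all P A && all P B.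
Proof. by rewrite (perm_all _ (perm_msetD A B)) all_cat. Qed.

Lemma has_msetD P A B : has P (A `+` B) = has P A || has P B.
Proof. by rewrite (perm_has _ (perm_msetD A B)) has_cat. Qed.

Lemma all_mset1 P a : all P [mset a] = P a.
Proof. by rewrite enum_msetn /= andbT. Qed.

Lemma has_mset1 P a : has P [mset a] = P a.
Proof. by rewrite enum_msetn /= orbF. Qed.

Lemma all_seq_mset P (s : seq K) : all P (seq_mset s) = all P s.
Proof. exact/perm_all/perm_eq_seq_mset. Qed.

Lemma seq_mset_cat (s t : seq K) : seq_mset (s ++ t) = seq_mset s `+` seq_mset t.
Proof. by apply/msetP => x; rewrite msetE2 !mset_seqE count_cat. Qed.

Lemma seq_mset_nil : seq_mset [::] = mset0 :> {mset K}.
Proof. by apply/msetP => x; rewrite mset_seqE mset0E. Qed.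

Lemma seq_mset1 (a : K) : seq_mset [:: a] = [mset a].
Proof. by rewrite mset_cons seq_mset_nil msetD0. Qed.

End MultisetSum.

(** * Symbol counts and factors of products *)

Definition mset_mass (G : {mset form}) : nat := \sum_(A <- G) form_size A.

Lemma sequent_sizeE G D :
  sequent_size (G ==>s D) = (mset_mass G + mset_mass D).+1.
Proof. by []. Qed.

Lemma mset_mass0 : mset_mass mset0 = 0.
Proof. by rewrite /mset_mass big_mset0. Qed.

Lemma mset_mass1 A : mset_mass [mset A] = form_size A.
Proof. by rewrite /mset_mass enum_msetn big_seq1. Qed.

Lemma mset_massD G H : mset_mass (G `+` H) = mset_mass G + mset_mass H.
Proof. by rewrite /mset_mass (perm_big _ (perm_msetD G H)) big_cat. Qed.

Lemma mset_mass_seq s : mset_mass (seq_mset s) = \sum_(A <- s) form_size A.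
Proof. exact/perm_big/perm_eq_seq_mset. Qed.

Definition massE :=
  (sequent_sizeE, mset_massD, mset_mass1, mset_mass0, mset_mass_seq, big_cons).

Lemma form_size_gt0 A : 0 < form_size A.
Proof. by case: A. Qed.

Fixpoint star_factors (A : form) : seq form :=
  if A is Star B C then star_factors B ++ star_factors C else [:: A].

Lemma mass_star_factors A :
  \sum_(B <- star_factors A) form_size B <= form_size A.
Proof.
elim: A => [p|||A _ B _|A _ B _|A IHA B IHB|A _ B _] /=; rewrite ?big_seq1 //.
rewrite big_cat /=; lia.
Qed.

Lemma size_star_factors A : size (star_factors A) <= form_size A.
Proof.
elim: A => //= A IHA B IHB; rewrite size_cat; lia.
Qed.

(** [k] atoms are joined by [k - 1] stars, giving [2k - 1] symbols. This exact count shows that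
    unfolding a product removes enough symbols to pay for its cost. *)
Lemma mass_atom_product Q : atom_product Q ->
  (\sum_(A <- star_factors Q) form_size A).*2 = (form_size Q).+1.
Proof.
elim=> [q|A B _ IHA _ IHB] /=; first by rewrite big_seq1.
rewrite big_cat /=; lia.
Qed.

Lemma atom_product_factors Q A :
  atom_product Q -> A \in star_factors Q -> exists q, A = Atom q.
Proof.
move=> hQ; elim: hQ => [q|B C _ IHB _ IHC] /=.
  by rewrite inE => /eqP ->; exists q.
by rewrite mem_cat => /orP [/IHB|/IHC].
Qed.

(** * Boolean semantics and soundness *)

Fixpoint eval (v : nat -> bool) (A : form) : bool :=
  match A with
  | Atom p => v p
  | Zero => false
  | One => true
  | And A B | Star A B => eval v A && eval v B
  | Or A B => eval v A || eval v B
  | Imp A B => eval v A ==> eval v B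
  end.

Lemma eval_star_factors v A : all (eval v) (star_factors A) = eval v A.
Proof.
by elim: A => [p|||A _ B _|A _ B _|A IHA B IHB|A _ B _] /=;
  rewrite ?andbT // all_cat IHA IHB.
Qed.

Definition sequent_valid (S : sequent) : Prop :=
  forall v, all (eval v) (antecedent S) -> has (eval v) (succedent S).

Lemma LKu_sound S : LKu_proof S -> sequent_valid S.
Proof.
move=> P v; apply/implyP.
(* With the truth values of formulas and cedents abstracted, each rule is a tautology checked by
   truth table. *)
elim: P => /= *;
  repeat match goal with H : is_true (_ ==> _) |- _ => move: H end;
  rewrite ?(all_msetD, has_msetD, all_mset1, has_mset1, enum_mset0) /=;
  repeat match goal with
  | |- context [eval v ?A] => case: (eval v A)
  | |- context [all (eval v) ?G] => case: (all (eval v) G)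
  | |- context [has (eval v) ?G] => case: (has (eval v) G)
  end => /=; by [].
Qed.

(** * Size-bounded derivability: primitive and derived rules *)

Definition proved_within (n : nat) (S : sequent) : Prop :=
  exists P : LKu_proof S, proof_size P <= n.

Lemma proved_within_leq m n S :
  m <= n -> proved_within m S -> proved_within n S.
Proof. by move=> mn [P hP]; exists P; apply: leq_trans mn. Qed.

Lemma proved_within_id A :
  proved_within (2 * form_size A).+1 ([mset A] ==>s [mset A]).
Proof. exists (LKu_id A); rewrite /= !massE; lia. Qed.

Lemma proved_within_oneL n G D : proved_within n (G ==>s D) ->
  proved_within (n + sequent_size (One +` G ==>s D)) (One +` G ==>s D).
Proof. move=> [P hP]; exists (LKu_oneL P) => /=; lia. Qed.

Lemma proved_within_weakL n G D A : proved_within n (G ==>s D) ->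
  proved_within (n + sequent_size (A +` G ==>s D)) (A +` G ==>s D).
Proof. move=> [P hP]; exists (LKu_weakL A P) => /=; lia. Qed.

Lemma proved_within_contrL n G D A : proved_within n (A +` (A +` G) ==>s D) ->
  proved_within (n + sequent_size (A +` G ==>s D)) (A +` G ==>s D).
Proof. move=> [P hP]; exists (LKu_contrL P) => /=; lia. Qed.

Lemma proved_within_starL n G D A B : proved_within n (A +` (B +` G) ==>s D) ->
  proved_within (n + sequent_size (Star A B +` G ==>s D)) (Star A B +` G ==>s D).
Proof. move=> [P hP]; exists (LKu_starL P) => /=; lia. Qed.

Lemma proved_within_starR m n G D S L A B :
  proved_within m (G ==>s A +` D) -> proved_within n (S ==>s B +` L) ->
  proved_within (m + n + sequent_size (G `+` S ==>s Star A B +` (D `+` L)))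
    (G `+` S ==>s Star A B +` (D `+` L)).
Proof. move=> [P hP] [Q hQ]; exists (LKu_starR P Q) => /=; lia. Qed.

Lemma proved_within_impL m n G D S L A B :
  proved_within m (G ==>s A +` D) -> proved_within n (B +` S ==>s L) ->
  proved_within (m + n + sequent_size (Imp A B +` (G `+` S) ==>s D `+` L))
    (Imp A B +` (G `+` S) ==>s D `+` L).
Proof. move=> [P hP] [Q hQ]; exists (LKu_impL P Q) => /=; lia. Qed.

Lemma proved_within_andL0 n G D A B : proved_within n (A +` G ==>s D) ->
  proved_within (n + sequent_size (And A B +` G ==>s D)) (And A B +` G ==>s D).
Proof. move=> [P hP]; exists (LKu_andL0 B P) => /=; lia. Qed.

Lemma proved_within_andL1 n G D A B : proved_within n (B +` G ==>s D) ->
  proved_within (n + sequent_size (And A B +` G ==>s D)) (And A B +` G ==>s D).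
Proof. move=> [P hP]; exists (LKu_andL1 A P) => /=; lia. Qed.

(** Each conjunct is introduced in its own copy of the conjunction, and the two copies are
    contracted. The three new sequents cost at most 2, 2 and 1 times the size of the conclusion. *)
Lemma proved_within_andL n G D A B :
  proved_within n (A +` (B +` G) ==>s D) ->
  proved_within (n + 5 * sequent_size (And A B +` G ==>s D))
    (And A B +` G ==>s D).
Proof.
move=> /(@proved_within_andL0 _ _ _ _ B); rewrite msetDCA.
move=> /(@proved_within_andL1 _ _ _ A) /proved_within_contrL.
apply: proved_within_leq; rewrite !massE /=; lia.
Qed.

Lemma proved_within_weak_seqL n (s : seq form) G D :
  proved_within n (G ==>s D) ->
  proved_within (n + size s * sequent_size (seq_mset s `+` G ==>s D))
    (seq_mset s `+` G ==>s D).
Proof.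
move=> hn; elim: s => [|A s /(@proved_within_weakL _ _ _ A)] /=.
  by rewrite seq_mset_nil mset0D addn0.
rewrite mset_cons -msetDA; apply: proved_within_leq.
rewrite !massE; nia.
Qed.

(** Each extra copy contracts into the occurrence in [G], which survives, so repetitions in [s] are
    harmless. *)
Lemma proved_within_contr_seqL n (s : seq form) G D :
  {subset s <= G} -> proved_within n (seq_mset s `+` G ==>s D) ->
  proved_within (n + size s * sequent_size (seq_mset s `+` G ==>s D)) (G ==>s D).
Proof.
elim: s n => [|A s IHs] n sG /=.
  by rewrite seq_mset_nil mset0D addn0.
have AG : A \in G by apply: sG; rewrite inE eqxx.
have {}sG : {subset s <= G} by move=> B Bs; apply: sG; rewrite inE Bs orbT.
rewrite mset_cons -msetDA => hn.
have {}hn : proved_within (n + sequent_size (seq_mset s `+` G ==>s D))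
    (seq_mset s `+` G ==>s D).
  move: hn; rewrite -(msetB1K AG) [seq_mset s `+` _]msetDCA.
  exact: proved_within_contrL.
apply: proved_within_leq (IHs _ sG hn); rewrite !massE; nia.
Qed.

(** One left star rule per star of [A]. Factors weigh no more than their product, so no new sequent
    exceeds the conclusion in size. *)
Lemma proved_within_factorsL n G D A :
  proved_within n (seq_mset (star_factors A) `+` G ==>s D) ->
  proved_within (n + form_size A * sequent_size (A +` G ==>s D)) (A +` G ==>s D).
Proof.
elim: A n G => [p|||A _ B _|A _ B _|A IHA B IHB|A _ B _] n G;
  try by rewrite seq_mset1; apply: proved_within_leq; rewrite leq_addr.
rewrite /= seq_mset_cat -msetDA msetDCA => /IHB; rewrite msetDCA => /IHA.
move=> /proved_within_starL; apply: proved_within_leq.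
have := mass_star_factors A; rewrite !massE /=; nia.
Qed.

(** A tree of right star rules over identities has at most [form_size A] sequents, each of size at
    most [2 * form_size A + 1]. *)
Lemma proved_within_factorsR A :
  proved_within (3 * form_size A ^ 2) (seq_mset (star_factors A) ==>s [mset A]).
Proof.
elim: A => [p|||A _ B _|A _ B _|A IHA B IHB|A _ B _];
  try by rewrite seq_mset1; apply: proved_within_leq (proved_within_id _);
         rewrite /=; nia.
rewrite /= seq_mset_cat.
move: IHA IHB; rewrite -[[mset A]]msetD0 -[[mset B]]msetD0 => IHA IHB.
have := proved_within_starR IHA IHB; rewrite !msetD0.
have := mass_star_factors A; have := mass_star_factors B.
move=> hA hB; apply: proved_within_leq; rewrite !massE /=; nia.
Qed.

(** The left premise of the implication rule is proved from fresh copies of the factors of [Q], so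
    [G] goes whole to the right premise; the copies are then contracted into [G]. *)
Lemma proved_within_fire n G D Q R :
  {subset star_factors Q <= G} ->
  proved_within n (seq_mset (star_factors R) `+` G ==>s D) ->
  proved_within
    (n + (5 * form_size Q + form_size R + 2) * sequent_size (Imp Q R +` G ==>s D))
    (Imp Q R +` G ==>s D).
Proof.
move=> QG /proved_within_factorsL hR.
have := proved_within_factorsR Q; rewrite -[[mset Q]]msetD0 => hQ.
have := proved_within_impL hQ hR; rewrite mset0D msetDCA.
move=> /proved_within_contr_seqL h.
have {}h := h (fun A AQ => mset1Dr _ (QG A AQ)).
(* With [q], [r] the sizes of [Q], [R] and [s] that of the conclusion: [3qs] for proving [Q], [rs]
   for unfolding [R], [2s] for the implication rule, [2qs] for the contractions. *)
apply: proved_within_leq h; rewrite !massE /=.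
have := mass_star_factors Q; have := size_star_factors Q; nia.
Qed.

(** * Saturated antecedents and the main induction *)

Definition inert (G : {mset form}) (F : form) : bool :=
  match F with
  | Atom _ => true
  | Imp Q _ => ~~ all (mem G) (star_factors Q)
  | _ => false
  end.

(** An inert implication lacks a hypothesis in [G], so the valuation given by the atoms of [G]
    satisfies it vacuously. *)
Lemma inert_valid (G : {mset form}) p :
  (forall F, F \in G -> implicational_horn F) -> all (inert G) G ->
  sequent_valid (G ==>s [mset Atom p]) -> Atom p \in G.
Proof.
move=> hG /allP iG /(_ (fun q => Atom q \in G)); rewrite /= has_mset1; apply.
have factorsG Q : atom_product Q ->
    eval (fun q => Atom q \in G) Q -> all (mem G) (star_factors Q).
  move=> hQ; rewrite -eval_star_factors => /allP vQ.
  apply/allP => A AQ; have [q Aq] := atom_product_factors hQ AQ.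
  by have := vQ A AQ; rewrite Aq.
apply/allP => F FG; have := iG F FG; have := FG.
case: (hG F FG) => //= [Q q hQ _ nQ|q Q _ _].
  by apply/implyP => /(factorsG Q hQ) QG; rewrite QG in nQ.
by rewrite andbT => /negbTE ->.
Qed.

Lemma valid_horn_proved_within (G : {mset form}) p :
  (forall F, F \in G -> implicational_horn F) ->
  sequent_valid (G ==>s [mset Atom p]) ->
  proved_within (6 * sequent_size (G ==>s [mset Atom p]) ^ 2)
    (G ==>s [mset Atom p]).
Proof.
set D := [mset Atom p].
have [m] := ubnP (mset_mass G); elim: m G => // m IHm G ltGm hG vG.
have [iG|/allPn [F FG niF]] := boolP (all (inert G) G).
  have pG := inert_valid hG iG vG; rewrite -(msetB1K pG).
  set H := G `\ Atom p; rewrite -(seq_mset_id H) msetDC.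
  have := proved_within_weak_seqL H (proved_within_id (Atom p)).
  apply: proved_within_leq; rewrite /D !massE /=.
  have : size H <= mset_mass H.
    rewrite /mset_mass -sum1_size; apply: leq_sum => A _; exact: form_size_gt0.
  rewrite /mset_mass; move: (size _) (bigop _ _ _) => k M; nia.
move: ltGm hG vG; rewrite -(msetB1K FG); set H := G `\ F => ltGm hG vG.
have hF : implicational_horn F by apply: hG; rewrite mset1D1.
have hH A : A \in H -> implicational_horn A by move=> AH; apply/hG/mset1Dr.
(* The induction hypothesis, packaged: [X] may replace [F] because a stronger antecedent keeps the
   sequent valid. *)
have step X : mset_mass X < form_size F ->
    (forall A, A \in X -> implicational_horn A) ->
    (forall v, all (eval v) X -> eval v F) ->
    proved_within (6 * sequent_size (X `+` H ==>s D) ^ 2) (X `+` H ==>s D).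
  move=> ltX hX vX; apply: IHm => [|A|v /=].
  - by move: ltGm; rewrite !massE; lia.
  - by rewrite in_msetD => /orP [/hX|/hH].
  - rewrite all_msetD => /andP [/vX vF vH]; apply: vG.
    by rewrite /= all_msetD all_mset1 vF.
(* An atom is a one-factor product, so this covers both Horn implication shapes. *)
have fire Q R : F = Imp Q R -> atom_product Q -> atom_product R ->
    proved_within (6 * sequent_size (F +` H ==>s D) ^ 2) (F +` H ==>s D).
  move=> eF hQ hR.
  (* The factors are atoms, hence distinct from the implication [F] and still present once it is
     consumed. *)
  have QH : {subset star_factors Q <= H}.
    move: niF; rewrite eF negbK => /allP QG A AQ.
    have [q eA] := atom_product_factors hQ AQ; have := QG A AQ.
    rewrite /= -(msetB1K FG) in_mset1D => /orP [/eqP AF|//].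
    by move: eF; rewrite -AF eA.
  have massR := mass_star_factors R; have massR2 := mass_atom_product hR.
  rewrite eF; apply: proved_within_leq
    (proved_within_fire QH (step (seq_mset (star_factors R)) _ _ _)).
  (* If [R] has [k] atoms, firing removes [q + k] symbols, so six times the square drops by at least
     [6(q + k)s], above the cost [(5q + 2k + 1)s]. *)
  - rewrite !massE /=; nia.
  - rewrite mset_mass_seq eF /=; lia.
  - move=> A; rewrite (perm_mem (perm_eq_seq_mset _)) => AR.
    by have [q ->] := atom_product_factors hR AR; constructor.
  - move=> v; rewrite all_seq_mset eval_star_factors eF /= => ->.
    exact: implybT.
case: hF niF step fire => [q||Q q hQ|q Q hQ|F1 F2 hF1 hF2] //= _ step fire.
- have := step mset0; rewrite mset_mass0 mset0D => hstep.
  apply: proved_within_leq (proved_within_oneL (hstep _ _ _)) => // [|A].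
    by rewrite !massE /=; nia.
  by rewrite in_mset0.
- by apply: fire erefl hQ _; constructor.
- by apply: fire erefl _ hQ; constructor.
have := step (F1 +` [mset F2]); rewrite -msetDA => hstep.
apply: proved_within_leq (proved_within_andL (hstep _ _ _)) => [||A|v].
- by rewrite !massE /=; nia.
- by rewrite !massE.
- by rewrite in_mset1D in_mset1 => /orP [] /eqP ->.
- by rewrite all_msetD !all_mset1.
Qed.

Theorem theorem29 :
  exists C : nat, forall S : sequent,
    implicational_horn_sequent S -> LKu_provable S ->
    exists P : LKu_proof S, proof_size P <= C * sequent_size S ^ 2.
Proof.
exists 6 => -[G D] [/= hG [p ->]] [P].
exact: valid_horn_proved_within hG (LKu_sound P).
Qed.
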